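(* For all $n,k\geq 0$, the number of permutations $\pi\in\mathfrak{S}_n(123)$ with $\mathrm{rbdes}(\pi)=k$ is the Narayana number $$N_{n,k}=\frac{1}{k+1}\binom{n-1}{k}\binom{n}{k}.$$
   Context: $\mathfrak{S}_n$ is the set of permutations $\pi=\pi_1\pi_2\cdots\pi_n$ of $[n]=\{1,\dots,n\}$ in one-line notation ($\mathfrak{S}_0$ consists of the empty permutation). $\mathfrak{S}_n(123)$ is the set of $\pi\in\mathfrak{S}_n$ having no length-three subsequence with the same relative order as $123$. For $\pi\in\mathfrak{S}_n$, an index $k\in[n]$ is a right big descent of $\pi$ if either $k\le n-1$ and $\pi_k>\pi_{k+1}+1$, or $k=n$ and $\pi_n>1$; equivalently, with the convention $\pi_{n+1}=0$, if $\pi_k>\pi_{k+1}+1$. $\mathrm{rbdes}(\pi)$ is the number of right big descents of $\pi$ (so it is $0$ for the empty permutation). Conventions: $\binom{a}{b}=0$ when $b>a\ge 0$, and $\binom{-1}{0}=1$ (relevant when $n=0$). *)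

(* Defs.v *)
From mathcomp Require Import all_boot all_order all_fingroup all_algebra.

Set Implicit Arguments.
Unset Strict Implicit.
Unset Printing Implicit Defensive.

Import GRing.Theory.

(* One-line notation, with letters in {1, ..., n}: a permutation of 'I_n takes
   its values in {0, ..., n-1}, hence the shift. *)
Definition one_line (n : nat) (s : 'S_n) : seq nat :=
  [seq (val (s i)).+1 | i <- enum 'I_n].

Definition contains123 (n : nat) (s : 'S_n) : bool :=
  [exists i : 'I_n, exists j : 'I_n, exists l : 'I_n,
    [&& i < j, j < l, s i < s j & s j < s l]].

Definition avoids123 (n : nat) (s : 'S_n) : bool := ~~ contains123 s.

(* Positions are 0-based.  At the last position the default value of [nth]
   supplies the convention pi_{n+1} = 0. *)
Definition right_big_descent (n : nat) (s : 'S_n) (i : 'I_n) : bool :=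
  nth 0 (one_line s) i > (nth 0 (one_line s) i.+1).+1.

Definition rbdes (n : nat) (s : 'S_n) : nat :=
  #|[set i : 'I_n | right_big_descent s i]|.

(* For n = 0 the truncated predecessor gives 'C(n.-1, k) = 'C(0, k), so that
   binom(-1, 0) = 1; for k > 0 the product vanishes because 'C(0, k) = 0. *)
Definition narayana (n k : nat) : rat :=
  (1 / k.+1%:R * 'C(n.-1, k)%:R * 'C(n, k)%:R)%R.

(* Main.v *)
(* Write a permutation as a word ending with the sentinel 0.  The 123-avoiding
   words on {0, ..., n+1} arise from those on {0, ..., n} by inserting n+1
   before a letter of the word so that the prefix to its left is decreasing.
   Apart from the initial one, each insertion site lies in the initial
   decreasing run or at the first ascent, and the number of big descents gained
   there, 0 or 1, is recorded by a word u of bits.  There are two kinds of words: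
   those that start with their maximum and those whose first ascent top is their
   maximum; the gains at the initial site and at the ascent depend on the kind.
   In both cases the generating polynomial of the descendants after k insertions
   is a linear combination of the elementary symmetric polynomials e_m of the
   monomials X^g, g in u.  The coefficients b_{k,m} for the second kind satisfy
     b_{k+1,m} = b_{k,m-1} + (1 + X) b_{k,m} + X b_{k,m+1},
   hence, by Lindstrom-Gessel-Viennot or directly from Pascal's rule,
     [X^j] b_{k,m} = C(k,j) C(k,j+m) - C(k,j-1) C(k,j+m+1).
   The insertion tree is rooted at the word 0, and the polynomial of its
   descendants at depth k+1 is b_{k,0}, the Narayana polynomial. *)
Require Import Defs.
From mathcomp Require Import all_boot all_order all_fingroup all_algebra.
From mathcomp Require Import ring zify.

Set Implicit Arguments.
Unset Strict Implicit.
Unset Printing Implicit Defensive.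

Import GRing.Theory.

(** * Inserting a new maximum *)

Fixpoint bdes_from (p : nat) (s : seq nat) : nat :=
  if s is y :: s' then (y.+1 < p) + bdes_from y s' else 0.

Definition bdes (w : seq nat) : nat := if w is x :: s then bdes_from x s else 0.

(* Insertions of m into s that remain active when s is preceded by a decreasing
   run ending with p. *)
Fixpoint insert_after (m p : nat) (s : seq nat) : seq (seq nat) :=
  if s is y :: s' then
    (m :: y :: s')
      :: (if y < p then [seq y :: z | z <- insert_after m y s'] else [::])
  else [::].

Definition insert_max (m : nat) (w : seq nat) : seq (seq nat) :=
  if w is x :: s then (m :: w) :: [seq x :: z | z <- insert_after m x s]
  else [::].

Fixpoint words (n : nat) : seq (seq nat) :=
  if n is n'.+1 then flatten [seq insert_max n w | w <- words n'] else [:: [:: 0]].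

(* A new maximum inserted into a descent of the word creates a big descent exactly
   when that descent was not big. *)
Fixpoint run_gains (p : nat) (s : seq nat) : seq bool :=
  if s is y :: s' then
    if y < p then (p == y.+1) :: run_gains y s' else [::]
  else [::].

(* Same, including the site at the first ascent, when the maximum of the word is
   not the ascent top; the inserted letter then always begins a big descent. *)
Fixpoint site_gains (p : nat) (s : seq nat) : seq bool :=
  if s is y :: s' then
    if y < p then (p == y.+1) :: site_gains y s' else [:: true]
  else [::].

Fixpoint first_ascent_top (M p : nat) (s : seq nat) : bool :=
  if s is y :: s' then
    if y < p then first_ascent_top M y s' else y == M
  else false.

Lemma insert_afterP m p s z :
  reflect (exists t1 t2, [/\ s = t1 ++ t2, z = t1 ++ m :: t2, t2 != [::]
             & path gtn p t1])
    (z \in insert_after m p s).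
Proof.
elim: s p z => [|y s IH] p z /=.
  by apply: (iffP idP) => // -[[|? ?] [[|? ?] []]].
rewrite inE; apply: (iffP orP) => [[/eqP->|]|].
- by exists [::], (y :: s).
- case: ifP => // yp /mapP[z' /IH[t1 [t2 [-> -> nt pt]]] ->].
  by exists (y :: t1), t2; split=> //=; rewrite yp.
- move=> [[|y' t1] [t2 [/= ]]]; first by move=> <- -> _ _; left; rewrite eqxx.
  move=> [<- es] -> nt /andP[yp pt]; right; rewrite yp; apply: map_f.
  by apply/IH; exists t1, t2.
Qed.

(** The inserted maximum ends the initial decreasing run, so non-initial insertions yield words of
    the second kind. *)
Lemma first_ascent_top_insert m p s z :
  (p < m) -> z \in insert_after m p s -> first_ascent_top m p z.
Proof.
move=> pm /insert_afterP[t1 [t2 [_ -> _]]].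
elim: t1 p pm => [|y t1 IH] p pm /=; first by rewrite ltnNge ltnW //= eqxx.
by case/andP=> yp; rewrite yp; apply: IH; apply: ltn_trans pm.
Qed.

(** * Generating polynomials over the insertion tree *)

Section Weights.

Local Open Scope ring_scope.
Local Notation P := {poly rat}.

Definition up (c : nat -> P) (m : nat) : P := if m is m'.+1 then c m' else 0.

Definition push (g : P) (c : nat -> P) (m : nat) : P := c m + g * c m.+1.

(* [esym c u] is the sum over m of c_m e_m(X^g : g in u), because
   e_m(y, u) = e_m(u) + y e_{m-1}(u). *)
Fixpoint esym (c : nat -> P) (u : seq bool) : P :=
  if u is g :: u' then esym (push ('X ^+ g) c) u' else c 0%N.

Lemma eq_esym c d u : c =1 d -> esym c u = esym d u.
Proof.
elim: u c d => [|g u IH] c d cd /=; first exact: cd.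
by apply: IH => m; rewrite /push !cd.
Qed.

Lemma esymD c d u (y : P) :
  esym (fun m => c m + y * d m) u = esym c u + y * esym d u.
Proof.
elim: u c d => [|g u IH] c d //=; rewrite -IH.
by apply: eq_esym => m; rewrite /push; ring.
Qed.

Lemma esym_rcons c u g : esym c (rcons u g) = esym (push ('X ^+ g) c) u.
Proof.
elim: u c => [|h u IH] c //=; rewrite IH.
by apply: eq_esym => m; rewrite /push; ring.
Qed.

Lemma esym_delta u (y : P) : esym (fun m => if m is 0%N then y else 0) u = y.
Proof.
elim: u => [|g u IH] //=; rewrite -[RHS]IH.
by apply: eq_esym => -[|m]; rewrite /push mulr0 addr0.
Qed.

Lemma esym_up_cons c g u :
  esym (up c) (g :: u) = 'X ^+ g * c 0%N + esym (up (push ('X ^+ g) c)) u.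
Proof.
rewrite -[in RHS](esym_delta u ('X ^+ g * c 0%N)).
rewrite -[X in _ + X]mul1r -esymD /=.
by apply: eq_esym => -[|m]; rewrite /push /=; ring.
Qed.

Lemma site_gainsE M p s :
  first_ascent_top M p s -> site_gains p s = rcons (run_gains p s) true.
Proof.
elim: s p => //= y s IH p; case: ltnP => // _ /IH -> //.
Qed.

(** Only the run gains left of the chosen site survive, and e_{m+1}(y_1,...,y_r) is the sum over i
    of y_i e_m(y_1,...,y_{i-1}). *)
Lemma sum_insert_top M p s (c : nat -> P) :
    (p <= M)%N -> all (ltn^~ M) s ->
  \sum_(z <- insert_after M.+1 p s) 'X ^+ bdes_from p z * esym c (run_gains p z)
    = 'X ^+ bdes_from p s * esym (up c) (site_gains p s).
Proof.
elim: s p c => [|y s IH] p c pM /=; first by rewrite big_nil mulr0.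
case/andP=> yM sM; rewrite big_cons /=.
have -> : (M.+2 < p)%N = false by lia.
have -> : (M.+1 < p)%N = false by lia.
rewrite ltnS yM add0n add1n exprS; case: ltnP => yp; last first.
  have -> : (y.+1 < p)%N = false by lia.
  by rewrite big_nil /= /push /=; ring.
rewrite esym_up_cons big_map /=.
under eq_bigr do rewrite yp exprD -mulrA /=.
rewrite -mulr_sumr IH //; last exact: ltnW.
rewrite exprD; case: (ltngtP p y.+1) yp => //= h _; rewrite ?h /=; try lia; ring.
Qed.

(** The second summand is the ascent site: M+1 right before M begins no big descent, and the whole
    run survives. *)
Lemma sum_insert_asc M p s (c : nat -> P) :
    (p <= M)%N -> first_ascent_top M p s ->
  \sum_(z <- insert_after M.+1 p s) 'X ^+ bdes_from p z * esym c (run_gains p z)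
    = 'X ^+ bdes_from p s
        * (esym (up c) (run_gains p s) + esym c (run_gains p s)).
Proof.
elim: s p c => [|y s IH] p c pM //=; rewrite big_cons /=.
have -> : (M.+2 < p)%N = false by lia.
have -> : (M.+1 < p)%N = false by lia.
case: ltnP => [yp fa|yp /eqP->]; last first.
  by rewrite ltnn big_nil (_ : (M.+1 < p)%N = false) /=; [ring|lia].
have -> : (y.+1 < M.+1)%N by lia.
rewrite esym_up_cons big_map /=.
under eq_bigr do rewrite yp exprD -mulrA /=.
rewrite -mulr_sumr IH //; last lia.
rewrite !exprD; case: (ltngtP p y.+1) yp => //= h _; rewrite ?h /=; try lia; ring.
Qed.

(* Coefficients for words that start with their maximum. *)
Fixpoint coef_top (k : nat) : nat -> P :=
  if k is k'.+1 then
    fun m => push 'X (coef_top k') m + up (push 'X (coef_top k')) m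
  else fun m => if m is 0%N then 1 else 0.

(* Coefficients for words whose first ascent top is their maximum. *)
Definition coef_asc (k : nat) : nat -> P := push 'X (coef_top k).

Fixpoint weight (k M : nat) (w : seq nat) : P :=
  if k is k'.+1 then \sum_(z <- insert_max M.+1 w) weight k' M.+1 z
  else 'X ^+ bdes w.

(** The two claims need each other: an initial insertion gives a word of the first kind, any other
    one of the second. *)
Lemma weightE k M :
  (forall s, all (ltn^~ M) s ->
     weight k M (M :: s)
       = 'X ^+ bdes_from M s * esym (coef_top k) (site_gains M s)) /\
  (forall x s, (x < M)%N -> all (leq^~ M) s -> first_ascent_top M x s ->
     weight k M (x :: s)
       = 'X ^+ bdes_from x s * esym (coef_asc k) (run_gains x s)).
Proof.
elim: k M => [|k IH] M.
  split=> [s _|x s _ _ _] /=.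
    by rewrite esym_delta mulr1.
  rewrite [X in _ * X](_ : _ = 1) ?mulr1 // -[RHS](esym_delta (run_gains x s)).
  by apply: eq_esym => -[|m]; rewrite /coef_asc /push mulr0 addr0.
have [IHA IHB] := IH M.+1.
have sumB x s : (x <= M)%N -> all (leq^~ M) s ->
    \sum_(z <- insert_after M.+1 x s) weight k M.+1 (x :: z)
    = \sum_(z <- insert_after M.+1 x s)
        'X ^+ bdes_from x z * esym (coef_asc k) (run_gains x z).
  move=> xM sM; rewrite big_seq [RHS]big_seq; apply: eq_bigr => z zi.
  apply: IHB => //; last exact: first_ascent_top_insert zi.
  case/insert_afterP: zi sM => t1 [t2 [-> -> _ _]].
  rewrite !all_cat /= leqnn /= => /andP[h1 h2].
  by apply/andP; split; [apply: sub_all h1|apply: sub_all h2] => i /=; lia.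
split=> [s sM|x s xM sM fa] /=; rewrite big_cons big_map sumB //.
- rewrite IHA /=; last by rewrite ltnSn; apply: sub_all sM => i /=; lia.
  (* M+1 before M makes a small descent, hence a site of gain 1. *)
  rewrite ltnSn ltnn add0n eqxx sum_insert_top // -mulrDr; congr (_ * _).
  rewrite /= -[X in _ + X]mul1r -esymD; apply: eq_esym => m.
  by rewrite mul1r.
- by apply: sub_all sM => i /=; lia.
- rewrite IHA /=; last by rewrite ltnS (ltnW xM); apply: sub_all sM => i /=; lia.
  (* M+1 before x < M makes a big descent, a site of gain 0; M is no longer the maximum, so the
     ascent site gains 1. *)
  have -> : (x < M.+1)%N by lia.
  have -> : (x.+1 < M.+1)%N by lia.
  have -> : (M.+1 == x.+1) = false by lia.
  rewrite (site_gainsE fa) (sum_insert_asc _ _ fa) 1?ltnW //= esym_rcons.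
  rewrite add1n exprS -mulrA mulrCA -mulrDr; congr (_ * _).
  rewrite -[esym (coef_asc k) _]mul1r -esymD addrC -esymD.
  apply: eq_esym => -[|m] /=; rewrite /coef_asc /push /= /push expr1 expr0; ring.
- exact: ltnW.
Qed.

Lemma sum_weight k n :
  \sum_(w <- words n) weight k n w = \sum_(w <- words (n + k)) 'X ^+ bdes w.
Proof.
elim: k n => [|k IH] n; first by rewrite addn0.
by rewrite addnS -addSn -IH /= big_flatten big_map.
Qed.

Lemma sum_words n : \sum_(w <- words n) 'X ^+ bdes w = coef_top n 0%N.
Proof.
have := sum_weight n 0; rewrite add0n => <-; rewrite big_seq1.
by have [-> //] := weightE n 0; rewrite mul1r.
Qed.

(** * Closed form of the coefficients *)

Lemma coef_asc_rec n m :
  coef_asc n.+1 m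
    = up (coef_asc n) m + (1 + 'X) * coef_asc n m + 'X * coef_asc n m.+1.
Proof. by rewrite /coef_asc /push /= /push; case: m => [|m] /=; ring. Qed.

Lemma coef_coef_asc n m k :
  (coef_asc n m)`_k
    = 'C(n, k)%:R * 'C(n, k + m)%:R
      - (if k is k'.+1 then 'C(n, k')%:R else 0) * 'C(n, (k + m).+1)%:R.
Proof.
elim: n m k => [|n IH] m k.
  rewrite /coef_asc /push /= mulr0 addr0.
  case: m => [|m]; rewrite ?coef1 ?coef0; case: k => [|k] //=;
  by rewrite ?addn0 ?addnS ?bin0n //= ?mulr0 ?mul0r ?subr0 ?mulr1.
rewrite coef_asc_rec; move: (coef_asc n) IH => f IH.
rewrite mulrDl mul1r !coefD !coefXM.
(* Boundary cases: [up] vanishes at m = 0, binom(n, k-1) at k = 0, binom(n, k-2) at k = 1. *)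
case: m => [|m]; case: k => [|[|k]] /=; rewrite ?coef0 ?IH;
  by rewrite ?(addn0, add0n, addSn, addnS, binS, bin0, natrD); ring.
Qed.

Lemma coef_narayana n k : (coef_top n 0%N)`_k = narayana n k.
Proof.
case: n => [|n].
  rewrite /= coef1 /narayana; case: k => [|k] //=.
  by rewrite !bin0n !mulr0.
rewrite /= addr0 -[push _ _ _]/(coef_asc n 0) coef_coef_asc addn0 /narayana /=.
have k0 : k.+1%:R != 0 :> rat by rewrite Num.Theory.pnatr_eq0.
apply: (mulfI k0); rewrite !mulrA mulr1 mulfV // mul1r.
case: k k0 => [|k] _; first by rewrite !bin0; ring.
(* Over [rat] this also holds for i > n, both sides being 0. Used at k and k+1, it reduces the claim
   to a ring identity. *)
have binr i : i.+1%:R * 'C(n, i.+1)%:R = (n%:R - i%:R) * 'C(n, i)%:R :> rat.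
  case: (leqP i n) => ni; last by rewrite !bin_small ?mulr0 // ltnW.
  by rewrite -natrB // -!natrM mul_bin_left.
have h1 := binr k; have h2 := binr k.+1.
rewrite mulrBr [_.+2%:R * (_ * 'C(n, k.+2)%:R)]mulrCA h2 binS natrD.
have -> : k.+2%:R = k.+1%:R + 1 :> rat by rewrite -natr1.
have -> : ('C(n, k)%:R * ((n%:R - k.+1%:R) * 'C(n, k.+1)%:R)
   = ((n%:R - k%:R) * 'C(n, k)%:R - 'C(n, k)%:R) * 'C(n, k.+1)%:R :> rat).
  by rewrite -natr1; ring.
by rewrite -h1; ring.
Qed.


End Weights.

(** * The tree consists of the 123-avoiding words *)

Fixpoint avoids (w : seq nat) : bool :=
  if w is x :: s then pairwise (fun y z => ~~ (x < y < z)) s && avoids s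
  else true.

(* A prefix ascent followed by the new maximum m would be an occurrence of 123. *)
Lemma avoids_insert m t1 t2 :
    all (ltn^~ m) (t1 ++ t2) ->
  avoids (t1 ++ m :: t2) = avoids (t1 ++ t2) && pairwise geq t1.
Proof.
elim: t1 => [|x t1 IH] /= h.
  rewrite andbT [X in X && _](_ : _ = true) //.
  elim: t2 h => //= y t2 IH /andP[ym /IH->]; rewrite andbT.
  by apply/allP => z _; lia.
case/andP: h => xm h; rewrite IH // !pairwise_cat /= !allrel_consr.
have -> : all (fun z => ~~ (x < m < z)) t2.
  by apply/allP => z zt; move/allP: h => /(_ z); rewrite mem_cat zt orbT; lia.
have -> : all (fun y => ~~ (x < y < m)) t1 = all (geq x) t1.
  apply: eq_in_all => y yt; move/allP: h => /(_ y); rewrite mem_cat yt /=; lia.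
by case: (all _ t1); rewrite /= ?andbF // !andbA.
Qed.

Lemma insert_maxP m w z :
  reflect (exists t1 t2, [/\ w = t1 ++ t2, z = t1 ++ m :: t2, t2 != [::]
             & sorted gtn t1])
    (z \in insert_max m w).
Proof.
case: w => [|x s] /=.
  by apply: (iffP idP) => // -[[|? ?] [[|? ?] []]].
rewrite inE; apply: (iffP orP) => [[/eqP->|]|].
- by exists [::], (x :: s).
- case/mapP=> z' /insert_afterP[t1 [t2 [-> -> nt pt]]] ->.
  by exists (x :: t1), t2.
- move=> [[|x' t1] [t2 [/= ]]]; first by move=> <- -> _ _; left; rewrite eqxx.
  move=> [<- es] -> nt pt; right; apply: map_f.
  by apply/insert_afterP; exists t1, t2.
Qed.

(** Deleting the maximum inverts an insertion; avoidance forces the prefix before it to decrease. *)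
Lemma mem_words n w :
  (w \in words n)
    = [&& perm_eq w (iota 0 n.+1), last 1 w == 0 & avoids w].
Proof.
elim: n w => [|n IH] w.
  rewrite inE; apply/eqP/and3P => [-> //|[/perm_small_eq-> //]].
have iotaS : perm_eq (n.+1 :: iota 0 n.+1) (iota 0 n.+2).
  by rewrite -[n.+2]addn1 iotaD add0n perm_sym perm_catC.
have bound t : perm_eq t (iota 0 n.+1) -> all (ltn^~ n.+1) t.
  by move=> /perm_mem pt; apply/allP => i; rewrite pt mem_iota.
apply/flatten_mapP/and3P => [[v]|[pw lw aw]].
  rewrite IH => /and3P[pv lv av] /insert_maxP[t1 [t2 [ev -> nt pt]]].
  subst v; split.
  - apply: perm_trans iotaS; rewrite -cat1s perm_catCA /= perm_cons //.
  - by case: t2 nt lv {pv av} => // y t2 _; rewrite !last_cat.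
  - rewrite avoids_insert ?bound // av -sorted_pairwise.
      by move: pt; rewrite gtn_sorted_uniq_geq => /andP[].
    by move=> i j l /= ji lj; apply: leq_trans lj ji.
have wn : n.+1 \in w by rewrite (perm_mem pw) mem_iota; lia.
case/splitPr: wn pw lw aw => t1 t2 pw lw aw.
have nt : t2 != [::] by case: t2 lw {pw aw}; rewrite // last_cat.
have pv : perm_eq (t1 ++ t2) (iota 0 n.+1).
  by rewrite -(perm_cons n.+1) (permPr iotaS) -cat1s perm_catCA.
move: aw; rewrite avoids_insert ?bound // => /andP[av gt1].
exists (t1 ++ t2).
  rewrite IH pv av andbT; by case: t2 nt lw {pv pw av} => // y t2 _; rewrite !last_cat.
apply/insert_maxP; exists t1, t2; split=> //.
(* Distinct letters turn weak decrease into strict. *)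
rewrite gtn_sorted_uniq_geq pairwise_sorted // andbT.
by have := perm_uniq pv; rewrite iota_uniq cat_uniq => /and3P[].
Qed.

(** * Sentinel and one-line notation *)

Lemma bdes_rcons p :
  bdes (rcons p 0) = \sum_(0 <= i < size p) ((nth 0 p i.+1).+1 < nth 0 p i).
Proof.
elim: p => [|x p IH]; first by rewrite big_nil.
(* Past the end of [p], the default 0 of [nth] stands for the sentinel. *)
rewrite big_nat_recl //=; case: p IH => [|y p] IH /=; first by rewrite big_nil.
by rewrite -IH.
Qed.

Lemma avoids_rcons0 p : avoids (rcons p 0) = avoids p.
Proof.
elim: p => //= x p ->; rewrite pairwise_rcons; congr (_ && _).
rewrite [X in X && _](_ : _ = true) //.
by apply/allP => y _; rewrite ltn0 andbF.
Qed.

Lemma avoidsP w :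
  reflect (forall i j l, i < j -> j < l -> l < size w ->
             ~~ (nth 0 w i < nth 0 w j < nth 0 w l))
    (avoids w).
Proof.
elim: w => [|x w IH] /=; first by left.
apply: (iffP andP) => [[/(pairwiseP 0) pw /IH av]|av].
  move=> [|i] [|j] [|l] //= ij jl lw; last exact: av.
  by apply: pw => //; apply: (ltn_trans jl lw).
split; last by apply/IH => i j l ij jl lw; apply: (av i.+1 j.+1 l.+1).
by apply/(pairwiseP 0) => j l _ lw jl; apply: (av 0 j.+1 l.+1).
Qed.

Lemma size_one_line n (s : 'S_n) : size (one_line s) = n.
Proof. by rewrite size_map size_enum_ord. Qed.

Lemma nth_one_line n (s : 'S_n) (i : 'I_n) : nth 0 (one_line s) i = (s i).+1.
Proof. by rewrite (nth_map i) ?size_enum_ord // nth_ord_enum. Qed.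

Lemma avoids_one_line n (s : 'S_n) : avoids (one_line s) = avoids123 s.
Proof.
apply/avoidsP/idP => [av|].
  apply/existsP => -[i /existsP[j /existsP[l /and4P[ij jl sij sjl]]]].
  have := av i j l ij jl; rewrite size_one_line ltn_ord !nth_one_line !ltnS.
  by rewrite sij sjl => /(_ isT).
move=> av i j l ij jl; rewrite size_one_line => ln.
have jn := ltn_trans jl ln; have ni := ltn_trans ij jn.
apply: contraNN av => /andP[].
rewrite (nth_one_line s (Ordinal ni)) (nth_one_line s (Ordinal jn)).
rewrite (nth_one_line s (Ordinal ln)) !ltnS => sij sjl.
apply/existsP; exists (Ordinal ni); apply/existsP; exists (Ordinal jn).
by apply/existsP; exists (Ordinal ln); apply/and4P.
Qed.

Lemma rbdes_one_line n (s : 'S_n) : bdes (rcons (one_line s) 0) = rbdes s.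
Proof.
rewrite bdes_rcons size_one_line big_mkord /rbdes -sum1dep_card [RHS]big_mkcond /=.
by apply: eq_bigr => i _; rewrite /right_big_descent; case: ifP.
Qed.

Lemma perm_one_line n (s : 'S_n) : perm_eq (one_line s) (iota 1 n).
Proof.
apply: uniq_perm (iota_uniq _ _) _.
  by rewrite map_inj_uniq ?enum_uniq // => i j [/val_inj/perm_inj].
move=> x; rewrite mem_iota add1n; apply/mapP/andP => [[i _ ->]|[x0 xn]].
  by split=> //; rewrite ltnS ltn_ord.
have xn' : x.-1 < n by lia.
by exists (s^-1%g (Ordinal xn')); rewrite ?mem_enum // permKV /=; lia.
Qed.

Lemma one_line_inj n : injective (@one_line n).
Proof.
move=> s t est; apply/permP => i; apply: val_inj.
by have := nth_one_line s i; rewrite est nth_one_line => -[].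
Qed.

Lemma one_line_surj n p : perm_eq p (iota 1 n) -> exists s : 'S_n, one_line s = p.
Proof.
move=> pp; have szp : size p = n by rewrite (perm_size pp) size_iota.
have up : uniq p by rewrite (perm_uniq pp) iota_uniq.
have rng (i : 'I_n) : 0 < nth 0 p i <= n.
  have : nth 0 p i \in p by rewrite mem_nth ?szp.
  by rewrite (perm_mem pp) mem_iota add1n ltnS.
have ltp (i : 'I_n) : (nth 0 p i).-1 < n by have := rng i; lia.
have inj : injective (fun i => Ordinal (ltp i)).
  move=> i j [eij]; apply/val_inj/eqP.
  rewrite -(nth_uniq 0 _ _ up) ?szp ?ltn_ord //; apply/eqP.
  by move: (nth 0 p i) (nth 0 p j) (rng i) (rng j) eij => [|a] [|b] //= _ _ ->.
exists (perm inj); apply: (@eq_from_nth _ 0); rewrite size_one_line ?szp //.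
move=> i ni; rewrite (nth_one_line _ (Ordinal ni)) permE /=.
by have := rng (Ordinal ni) => /=; lia.
Qed.

(** * Each word arises once *)

Lemma uniq_flatten_map (S T : eqType) (f : S -> seq T) (r : T -> S) (s : seq S) :
    uniq s -> {in s, forall x, uniq (f x)} ->
    {in s, forall x, {in f x, forall z, r z = x}} ->
  uniq (flatten [seq f x | x <- s]).
Proof.
elim: s => //= x s IH /andP[xs us] uf rf.
rewrite cat_uniq uf ?mem_head // IH //=; first last.
- by move=> y ys; apply: rf; rewrite inE ys orbT.
- by move=> y ys; apply: uf; rewrite inE ys orbT.
rewrite andbT; apply: contraNN xs => /hasP[z /flatten_mapP[y ys zy] zx].
by rewrite -(rf x (mem_head _ _) z zx) (rf y _ z zy) // inE ys orbT.
Qed.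

Lemma uniq_insert_after m p s : m \notin s -> uniq (insert_after m p s).
Proof.
elim: s p => //= y s IH p; rewrite inE negb_or => /andP[my ms].
case: ifP => // _; rewrite map_inj_uniq; last by move=> ? ? [].
rewrite IH // andbT; apply/mapP => -[z _ [my']].
by rewrite my' eqxx in my.
Qed.

Lemma uniq_insert_max m w : m \notin w -> uniq (insert_max m w).
Proof.
case: w => //= x s; rewrite inE negb_or => /andP[mx ms].
rewrite map_inj_uniq; last by move=> ? ? [].
rewrite uniq_insert_after // andbT; apply/mapP => -[z _ [mx']].
by rewrite mx' eqxx in mx.
Qed.

Lemma uniq_words n : uniq (words n).
Proof.
elim: n => //= n IH.
have notin w : w \in words n -> n.+1 \notin w.
  by rewrite mem_words => /and3P[/perm_mem -> _ _]; rewrite mem_iota; lia.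
(* Deleting n+1 recovers the parent word. *)
apply: (uniq_flatten_map (r := rem n.+1)) => // w wn.
  exact/uniq_insert_max/notin.
move=> z /insert_maxP[t1 [t2 [ew -> _ _]]]; rewrite ew.
have: n.+1 \notin t1 by move: (notin _ wn); rewrite ew mem_cat negb_or => /andP[].
elim: t1 {ew} => [|x t1 IH1] /=; first by rewrite eqxx.
by rewrite inE negb_or eq_sym => /andP[/negPf-> /IH1->].
Qed.

Lemma words_one_line n :
  perm_eq (words n) [seq rcons (one_line s) 0 | s : 'S_n in @avoids123 n].
Proof.
have iotaS p : perm_eq (rcons p 0) (iota 0 n.+1) = perm_eq p (iota 1 n).
  by rewrite perm_rcons perm_cons.
apply: uniq_perm (uniq_words n) _ _.
  by rewrite map_inj_uniq ?enum_uniq // => s t /rcons_inj[/one_line_inj].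
move=> w; rewrite mem_words; apply/and3P/imageP => [|[s sav ->]]; last first.
  by rewrite iotaS perm_one_line last_rcons avoids_rcons0 avoids_one_line.
case/lastP: w => [[]//|p x]; rewrite last_rcons => -[pw /eqP x0].
subst x; move: pw; rewrite iotaS avoids_rcons0 => /one_line_surj[s <-].
by rewrite avoids_one_line => sav; exists s.
Qed.

Theorem theorem2p14 (n k : nat) :
  (#|[set s : 'S_n | avoids123 s & rbdes s == k]|%:R)%R = narayana n k.
Proof.
rewrite -coef_narayana -sum_words coef_sum.
rewrite (perm_big _ (words_one_line n)) /= big_image /=.
under eq_bigr do rewrite coefXn rbdes_one_line eq_sym.
rewrite -natr_sum -sum1dep_card big_mkcondr /=; congr (_%:R)%R.
Qed.
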